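(* Let $r$ be a positive integer with $r\equiv 3\pmod 4$. There is no $Q$-polynomial association scheme with Krein array $$\left\{\frac{r^2+1}{2},\ \frac{r^2-1}{2},\ \frac{(r^2+1)^2}{2r(r+1)},\ \frac{(r-1)(r^2+1)}{4r},\ \frac{r^2+1}{2r};\ 1,\ \frac{(r-1)(r^2+1)}{2r(r+1)},\ \frac{(r+1)(r^2+1)}{4r},\ \frac{(r-1)(r^2+1)}{2r},\ \frac{r^2+1}{2}\right\}.$$
   Context: A (symmetric) association scheme with $D$ classes is a pair $(X,\{R_i\}_{i=0}^D)$ where $X$ is a finite set and $R_0,\dots,R_D$ are non-empty subsets of $X\times X$ whose adjacency matrices $A_0,\dots,A_D$ satisfy: $A_0=I$, $\sum_i A_i=J$, $A_i^\top=A_i$, and $A_iA_j=\sum_k p_{ij}^kA_k$ for nonnegative integers $p_{ij}^k$. The real span of the $A_i$ has a basis of primitive idempotents $E_0=\frac{1}{|X|}J,E_1,\dots,E_D$, closed under entrywise product $\circ$; the Krein parameters $q_{ij}^k$ are defined by $E_i\circ E_j=\frac1{|X|}\sum_k q_{ij}^kE_k$. An ordering $E_1,\dots,E_D$ is $Q$-polynomial if $(q_{1j}^k)_{k,j=0}^D$ is tridiagonal with all superdiagonal and subdiagonal entries nonzero; then with $b_i^*=q_{1,i+1}^i$, $c_i^*=q_{1,i-1}^i$, the Krein array is $\{b_0^*,\dots,b_{D-1}^*;c_1^*,\dots,c_D^*\}$. A $Q$-polynomial association scheme with a given Krein array is one admitting a $Q$-polynomial ordering with that Krein array. *)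

(* Defs.v *)
From HB Require Import structures.
From mathcomp Require Import all_boot all_order all_algebra.
From mathcomp Require Import reals.

Set Implicit Arguments.
Unset Strict Implicit.
Unset Printing Implicit Defensive.

Import Order.TTheory GRing.Theory Num.Theory.

Local Open Scope ring_scope.

(* Matrices indexed by a finite set X are square matrices of order #|X|, with *)
(* rows and columns labelled through the enumeration [enum_val] of X.         *)
Definition adjmx (R : realType) (X : finType) (S : {set X * X}) : 'M[R]_#|X| :=
  \matrix_(i, j) ((enum_val i, enum_val j) \in S)%:R.

Definition hadamard (R : realType) (m n : nat) (M N : 'M[R]_(m, n)) :
    'M[R]_(m, n) :=
  map2_mx *%R M N.

Section Scheme.

Variables (R : realType) (X : finType) (D : nat).

Local Notation classes := ('I_D.+1).
Local Notation mxX := ('M[R]_#|X|).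

Definition assoc_scheme (rel : classes -> {set X * X}) : Prop :=
  let A i : mxX := adjmx R (rel i) in
  [/\ forall i, rel i != set0,
      A ord0 = 1%:M,
      \sum_i A i = const_mx 1,
      forall i, (A i)^T = A i
    & exists p : classes -> classes -> classes -> nat,
        forall i j, A i *m A j = \sum_k (p i j k)%:R *: A k].

Definition bose_mesner (rel : classes -> {set X * X}) : {vspace mxX} :=
  <<[seq adjmx R (rel i) | i : classes]>>%VS.

Definition idempotent_in (V : {vspace mxX}) (E : mxX) : Prop :=
  E \in V /\ E *m E = E.

Definition primitive_idempotent (V : {vspace mxX}) (E : mxX) : Prop :=
  [/\ idempotent_in V E, E != 0
    & forall F G : mxX, idempotent_in V F -> idempotent_in V G ->
        F *m G = 0 -> G *m F = 0 -> E = F + G -> F = 0 \/ G = 0].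

Definition primitive_idempotent_basis
    (rel : classes -> {set X * X}) (E : classes -> mxX) : Prop :=
  [/\ E ord0 = #|X|%:R^-1 *: const_mx 1,
      forall i, primitive_idempotent (bose_mesner rel) (E i)
    & basis_of (bose_mesner rel) [seq E i | i : classes]].

(* [q i j k] stands for q_{ij}^k; it is uniquely determined by [E] whenever   *)
(* the E i are linearly independent.                                          *)
Definition krein_parameters
    (E : classes -> mxX) (q : classes -> classes -> classes -> R) : Prop :=
  forall i j, hadamard (E i) (E j) = #|X|%:R^-1 *: \sum_k q i j k *: E k.

(* [inord 1] is the class of index 1, as 0 < D.                               *)
Definition Q_polynomial (q : classes -> classes -> classes -> R) : Prop :=
  (0 < D)%N /\
  forall j k : classes,
    [/\ (j.+1 < k)%N \/ (k.+1 < j)%N -> q (inord 1) j k = 0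
      & (j.+1 == k)%N \/ (k.+1 == j)%N -> q (inord 1) j k != 0].

(* [b] lists b*_0, ..., b*_{D-1}, while [c] lists c*_1, ..., c*_D; hence the  *)
(* entry of index i of [c] is c*_{i+1} = q_{1,i}^{i+1}.                       *)
Definition krein_array
    (q : classes -> classes -> classes -> R) (b c : seq R) : Prop :=
  [/\ size b = D, size c = D
    & forall i, (i < D)%N ->
        b`_i = q (inord 1) (inord i.+1) (inord i) /\
        c`_i = q (inord 1) (inord i) (inord i.+1)].

Definition Q_polynomial_scheme
    (rel : classes -> {set X * X}) (b c : seq R) : Prop :=
  assoc_scheme rel /\
  exists (E : classes -> mxX) (q : classes -> classes -> classes -> R),
    [/\ primitive_idempotent_basis rel E, krein_parameters E q,
        Q_polynomial q & krein_array q b c].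

End Scheme.

(* Main.v *)
(* Every a*_i vanishes, so an entry t of |X| E_1 is a root of
   (t^2 - m^2) (t^2 - m^2 / r) (t^2 - m^2 / r^2), where m = (r^2 + 1) / 2. The
   scheme is thus an antipodal double cover of a graph with the parameters of
   the collinearity graph of a generalized quadrangle GQ(r, r), whose edges (the
   pairs with t = m / sqrt r or - m / sqrt r) it signs by a matrix S. Whenever
   q_{ij}^k = 0, the projection E_k annihilates all entrywise products of a row
   of E_i and a row of E_j; for q_{11}^4, q_{55}^4 and q_{15}^2 this shows that
   two non-adjacent neighbours of z have no common neighbour adjacent to z, so
   the neighbourhood of z in the quotient is a disjoint union of r-cliques.
   After making all signs at z positive, S has zero row sums on such a clique,
   so that half of its r (r - 1) ordered pairs have sign 1. Their number is even
   by symmetry, hence 4 divides r (r - 1). *)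

Require Import Defs.
From mathcomp Require Import all_boot all_order all_algebra.
From mathcomp Require Import reals ring lra zify.

Import Order.TTheory GRing.Theory Num.Theory.

Local Open Scope ring_scope.

Set Implicit Arguments.
Unset Strict Implicit.
Unset Printing Implicit Defensive.

Local Notation "M ⊙ N" := (map2_mx *%R M N) (at level 40, left associativity).

Lemma trmx_entryC (R : Type) (n : nat) (M : 'M[R]_n) (a b : 'I_n) :
  M^T = M -> M a b = M b a.
Proof. by move=> trM; rewrite -[in LHS]trM mxE. Qed.

Lemma psumr2_eq0 (R : numDomainType) (I J : finType) (F : I -> J -> R) :
    (forall i j, 0 <= F i j) -> \sum_i \sum_j F i j = 0 ->
  forall i j, F i j = 0.
Proof.
move=> F_ge0 sumF i j.
have rowF : \sum_j F i j = 0.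
  by apply: (psumr_eq0P _ sumF) => // k _; apply: sumr_ge0.
exact: (psumr_eq0P _ rowF).
Qed.

(* As C is a projection, the squared norm of u C is u C u^T = tr (C u^T u) for
   every row u; summed over the products u of a row of A and a row of B this
   gives tr (C (A ⊙ B)) = 0. *)
Lemma hadamard_rows_mul_eq0 (R : realDomainType) (n : nat) (A B C : 'M[R]_n) :
    A^T = A -> B^T = B -> C^T = C ->
    A *m A = A -> B *m B = B -> C *m C = C ->
    (A ⊙ B) *m C = 0 ->
  forall a b, (row a A ⊙ row b B) *m C = 0.
Proof.
move=> trA trB trC AA BB CC ABC0.
pose u a b := row a A ⊙ row b B; pose N a b := (u a b *m C *m (u a b)^T) 0 0.
have normE a b : N a b = \sum_w (u a b *m C) 0 w ^+ 2.
  rewrite /N -{1}CC -{2}trC -!mulmxA -trmx_mul mulmxA mxE.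
  by apply: eq_bigr => w _; rewrite [_^T _ _]mxE.
have gram (M : 'M[R]_n) v w : M^T = M -> M *m M = M ->
    \sum_a M a v * M a w = M v w.
  move=> trM MM; rewrite -[in RHS]MM mxE.
  by apply: eq_bigr => a _; rewrite (trmx_entryC a v).
have outer : \sum_a \sum_b (u a b)^T *m u a b = A ⊙ B.
  apply/matrixP => v w; rewrite summxE mxE -(gram A) // -(gram B) // mulr_suml.
  apply: eq_bigr => a _; rewrite summxE mulr_sumr; apply: eq_bigr => b _.
  by rewrite mxE big_ord1 !mxE; ring.
have sumN : \sum_a \sum_b N a b = 0.
  transitivity (\tr (\sum_a \sum_b (u a b)^T *m u a b *m C)).
    rewrite linear_sum; apply: eq_bigr => a _; rewrite linear_sum.
    apply: eq_bigr => b _ /=.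
    by rewrite /N -trace_mx11 mxtrace_mulC mulmxA.
  rewrite (eq_bigr (fun a => (\sum_b (u a b)^T *m u a b) *m C)) => [|a _].
    by rewrite -mulmx_suml outer ABC0 mxtrace0.
  by rewrite mulmx_suml.
move=> a b; apply/rowP => w; rewrite [RHS]mxE.
have N0 : N a b = 0.
  apply: psumr2_eq0 sumN a b => a b.
  by rewrite normE; apply: sumr_ge0 => ? _; exact: sqr_ge0.
apply/eqP; rewrite -sqrf_eq0; apply/eqP.
by move: N0; rewrite normE => /psumr_eq0P-> // ? _; exact: sqr_ge0.
Qed.

Definition orthogonal_idempotents (R : pzRingType) (n D : nat)
    (E : 'I_D -> 'M[R]_n) : Prop :=
  forall k l, E k *m E l = if k == l then E k else 0.

Definition orthogonal_resolution (R : pzRingType) (n D : nat)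
    (E : 'I_D -> 'M[R]_n) : Prop :=
  [/\ forall l, (E l)^T = E l, orthogonal_idempotents E & \sum_l E l = 1%:M].

Definition spectral_mx (R : pzRingType) (n D : nat) (E : 'I_D -> 'M[R]_n)
    (c : 'I_D -> R) : 'M[R]_n :=
  \sum_l c l *: E l.

Section SpectralMatrices.

Variables (R : comPzRingType) (n D : nat) (E : 'I_D -> 'M[R]_n).
Implicit Types (c d : 'I_D -> R).

Lemma eq_spectral_mx c d : c =1 d -> spectral_mx E c = spectral_mx E d.
Proof. by move=> cd; apply: eq_bigr => l _; rewrite cd. Qed.

Lemma scale_spectral_mx k c :
  k *: spectral_mx E c = spectral_mx E (fun l => k * c l).
Proof. by rewrite scaler_sumr; apply: eq_bigr => l _; rewrite scalerA. Qed.

Hypothesis orthoE : orthogonal_idempotents E.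

Lemma mul_spectral_idempotent c k : spectral_mx E c *m E k = c k *: E k.
Proof.
rewrite mulmx_suml (bigD1 k) //= -scalemxAl orthoE eqxx.
by rewrite big1 ?addr0 // => l /negbTE lk; rewrite -scalemxAl orthoE lk scaler0.
Qed.

Lemma mul_spectral_mx c d :
  spectral_mx E c *m spectral_mx E d = spectral_mx E (fun l => c l * d l).
Proof.
rewrite [in LHS]/(spectral_mx E d) mulmx_sumr; apply: eq_bigr => l _.
by rewrite -scalemxAr mul_spectral_idempotent scalerA mulrC.
Qed.

End SpectralMatrices.

Lemma spectral_mx_inj (R : fieldType) (n D : nat) (E : 'I_D -> 'M[R]_n)
    (c d : 'I_D -> R) :
    orthogonal_idempotents E -> (forall k, E k != 0) ->
  spectral_mx E c = spectral_mx E d -> c =1 d.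
Proof.
move=> orthoE E_neq0 cd k; move/(congr1 (mulmx^~ (E k))): cd.
rewrite !mul_spectral_idempotent // => /eqP; rewrite -subr_eq0 -scalerBl.
by rewrite scaler_eq0 (negbTE (E_neq0 k)) orbF subr_eq0 => /eqP.
Qed.

(* When E comes from an association scheme, c l = q_{ij}^l / |X|: the products
   of a row of E i and a row of E j lie in the sum of the images of the E l with
   q_{ij}^l <> 0. *)
Lemma hadamard_rows_mul_spectral (R : realDomainType) (n D : nat)
    (E : 'I_D -> 'M[R]_n) (i j : 'I_D) (c mu : 'I_D -> R) (theta : R)
    (a b : 'I_n) :
    orthogonal_resolution E -> E i ⊙ E j = spectral_mx E c ->
    (forall l, c l != 0 -> mu l = theta) ->
  (row a (E i) ⊙ row b (E j)) *m spectral_mx E mu =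
    theta *: (row a (E i) ⊙ row b (E j)).
Proof.
move=> [trE orthoE sumE] Eij muE; set u := _ ⊙ _.
rewrite -[in RHS](mulmx1 u) -sumE !mulmx_sumr scaler_sumr.
apply: eq_bigr => l _; rewrite -scalemxAr.
have [cl0|/muE-> //] := eqVneq (c l) 0.
suff -> : u *m E l = 0 by rewrite !scaler0.
apply: hadamard_rows_mul_eq0; rewrite ?orthoE ?eqxx //.
by rewrite Eij mul_spectral_idempotent // cl0 scale0r.
Qed.

Lemma symmetric_sum_even (T : finType) (f : T -> T -> nat) :
    (forall a b, f a b = f b a) -> (forall a, f a a = 0%N) ->
  ~~ odd (\sum_a \sum_b f a b).
Proof.
move=> fC f0; pose lt (a b : T) := (enum_rank a < enum_rank b)%N.
have gtE : (\sum_a \sum_(b | lt b a) f a b = \sum_a \sum_(b | lt a b) f a b)%N.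
  rewrite (exchange_big_dep predT) //=.
  by apply: eq_bigr => a _; apply: eq_bigr => b _.
suff -> : (\sum_a \sum_b f a b = (\sum_a \sum_(b | lt a b) f a b).*2)%N.
  by rewrite odd_double.
rewrite -addnn -[X in (_ = _ + X)%N]gtE -big_split; apply: eq_bigr => a _ /=.
rewrite (bigID (lt a)) /=; congr (_ + _)%N.
rewrite (bigD1 a) /lt ?ltnn //= f0 add0n; apply: eq_bigl => b.
by rewrite -leqNgt ltn_neqAle (inj_eq val_inj) (inj_eq enum_rank_inj) andbC.
Qed.

Definition is_sign (R : pzRingType) (e : R) : Prop := e = 1 \/ e = -1.

(* The pairs with sign 1 are half of all pairs, and their number is even. *)
Lemma dvdn4_balanced_signs (R : numDomainType) (T : finType) (L : {set T})
    (S : T -> T -> R) :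
    (forall u w, S u w = S w u) -> (forall u, S u u = 0) ->
    {in L &, forall u w, u != w -> is_sign (S u w)} ->
    {in L, forall u, \sum_(w in L) S u w = 0} ->
  (4 %| #|L| * #|L|.-1)%N.
Proof.
move=> symS diagS signS sumS.
pose f u w := nat_of_bool [&& u \in L, w \in L & S u w == 1].
have f_even : ~~ odd (\sum_u \sum_w f u w).
  apply: symmetric_sum_even => [u w|u]; first by rewrite /f andbCA symS.
  by rewrite /f diagS eq_sym oner_eq0 !andbF.
have fE u w : u \in L -> w \in L -> (2 * f u w)%:R = (w != u)%:R + S u w.
  move=> uL wL; rewrite /f uL wL (eq_sym w).
  have [->|uw] := eqVneq u w; first by rewrite diagS addr0 eq_sym oner_eq0.
  have [->|->] := signS u w uL wL uw; first by rewrite eqxx muln1.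
  by rewrite subrr lt_eqF ?muln0 // (lt_trans (ltrN10 R)) ?ltr01.
have sumf u : u \in L -> (2 * \sum_w f u w = #|L|.-1)%N.
  move=> uL; apply/eqP; rewrite -(eqr_nat R) (cardsD1 u) uL big_distrr natr_sum.
  rewrite (bigID (mem L)) /= [X in _ + X]big1 ?addr0 => [|w /negbTE wL].
    rewrite (eq_bigr _ (fun w => fE u w uL)) big_split /= sumS // addr0.
    rewrite -natr_sum -sum1_card; under [X in _ == X%:R]eq_bigl => w.
      by rewrite !inE andbC; over.
    by rewrite big_mkcondr.
  by rewrite /f wL andbF.
have -> : (#|L| * #|L|.-1 = 2 * \sum_u \sum_w f u w)%N.
  rewrite (bigID (mem L)) /= [X in (_ + X)%N]big1 ?addn0 => [|u /negbTE uL].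
    by rewrite big_distrr -sum_nat_const; apply: eq_bigr => u /sumf.
  by apply: big1 => w _; rewrite /f uL.
by rewrite -(even_halfK f_even) -muln2; lia.
Qed.

Section SignedLines.

Variables (R : numFieldType) (n r : nat) (S : 'M[R]_n).

Local Notation B := (S ⊙ S).

Hypothesis trS : S^T = S.
Hypothesis diagS : forall a, S a a = 0.
Hypothesis signS : forall a b, [\/ S a b = 0, S a b = 1 | S a b = -1].
Hypothesis mulBS : B *m S = 0.
Hypothesis adjS2 : forall a b, S a b != 0 -> (S *m S) a b = 0.
Hypothesis adjB2 : forall a b, S a b != 0 -> (B *m B) a b = 2 * (r%:R - 1).
Hypothesis adj_trans : forall a b c w, S c a != 0 -> S c a = S c b ->
  S c w != 0 -> S a w != 0 -> S b w != 0 -> a = b \/ S a b != 0.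

(* When S signs the collinearity graph of a generalized quadrangle, this is the
   line through c and y without c. *)
Definition signed_line (c y : 'I_n) : {set 'I_n} :=
  [set u | (S c u == S c y) && ((u == y) || (S y u != 0))].

Variables c y : 'I_n.
Hypothesis cy : S c y != 0.

Local Notation L := (signed_line c y).

Let symS a b : S a b = S b a.
Proof. exact: trmx_entryC. Qed.

Lemma sum_same_sign (M : 'M[R]_n) w :
  \sum_(u | S c u == S c y) M w u =
    ((M *m B) w c + S c y * (M *m S) w c) / 2.
Proof.
rewrite !mxE mulr_sumr -big_split mulr_suml big_mkcond /=.
apply: eq_bigr => u _; rewrite mxE (symS u c).
have N1_neq1 : (-1 == 1 :> R) = false by rewrite lt_eqF ?(lt_trans (ltrN10 R)).
have sign_neq := (N1_neq1, oner_eq0 R, oppr_eq0 (1 : R)).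
by case: (signS c u) (signS c y) cy => -> [] -> //;
  rewrite ?eqxx ?sign_neq ?(eq_sym _ (-1)) ?(eq_sym 0) ?sign_neq // => _; field.
Qed.

Lemma signed_line_sign u : u \in L -> S c u = S c y.
Proof. by rewrite inE => /andP[/eqP]. Qed.

Lemma signed_line_adj u w : u \in L -> w \in L -> u != w -> S u w != 0.
Proof.
move=> uL wL; have cu := signed_line_sign uL; have cw := signed_line_sign wL.
move: uL wL; rewrite !inE.
case/andP=> _ /orP[/eqP-> | yu] /andP[_ /orP[/eqP-> | yw]] uw.
- by rewrite eqxx in uw.
- by [].
- by rewrite symS.
have [] // := @adj_trans u w c y; rewrite ?cu ?cw // 1?symS //.
by move=> uw_eq; rewrite uw_eq eqxx in uw.
Qed.

Lemma signed_line_closed u w :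
  u \in L -> S c w = S c y -> S u w != 0 -> w \in L.
Proof.
move=> uL cw uw; have cu := signed_line_sign uL.
rewrite inE cw eqxx /=; have [-> //|wy] := eqVneq w y.
move: uL; rewrite inE => /andP[_ /orP[/eqP uy|yu]]; first by rewrite -uy.
have [] := @adj_trans w y c u; rewrite ?cw ?cu //= 1?symS //.
by move=> wy_eq; rewrite wy_eq eqxx in wy.
Qed.

Lemma signed_line_row_sum u : u \in L -> \sum_(w in L) S u w = 0.
Proof.
move=> uL; transitivity (\sum_(w | S c w == S c y) S u w).
  rewrite [RHS](bigID (mem L)) /= [X in _ + X]big1 ?addr0 => [|w].
    by apply: eq_bigl => w; rewrite inE; case: eqP.
  by case/andP=> /eqP cw; apply: contraNeq => /(signed_line_closed uL cw).
have mulSB : S *m B = 0.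
  have trB : B^T = B by rewrite map2_trmx trS.
  by rewrite -[LHS]trmxK trmx_mul trB trS mulBS trmx0.
rewrite sum_same_sign mulSB mxE adjS2; last first.
  by rewrite symS (signed_line_sign uL).
by rewrite mulr0 addr0 mul0r.
Qed.

Lemma card_signed_line : #|L| = r.
Proof.
apply/eqP; rewrite -(eqr_nat R) -sum1_card natr_sum.
have yL : y \in L by rewrite inE !eqxx.
rewrite (bigD1 y) //=.
rewrite (_ : \sum_(u in L | u != y) _ = \sum_(u | S c u == S c y) B y u).
  rewrite sum_same_sign mulBS [(0 : 'M_n) y c]mxE adjB2 1?symS //.
  by apply/eqP; field.
rewrite big_mkcond [RHS]big_mkcond; apply: eq_bigr => u _ /=.
rewrite !inE mxE; case: eqP => //= _; case: eqVneq => [->|_] /=.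
  by rewrite diagS mulr0.
rewrite andbT; case: (signS y u) => ->;
  by rewrite ?eqxx ?mulr0 ?oppr_eq0 ?oner_eq0 ?mulrNN ?mulr1.
Qed.

Lemma dvdn4_signed_line : (4 %| r * r.-1)%N.
Proof.
rewrite -card_signed_line; apply: (dvdn4_balanced_signs (S := S)) => //.
- move=> u w uL wL uw; have := signed_line_adj uL wL uw.
  by case: (signS u w) => ->; rewrite ?eqxx; [|left|right].
- exact: signed_line_row_sum.
Qed.

End SignedLines.

Lemma mem_span_image (K : fieldType) (V : vectType K) (I : finType)
    (F : I -> V) (u : V) :
    u \in <<[seq F i | i : I]>>%VS ->
  exists c : I -> K, u = \sum_i c i *: F i.
Proof.
rewrite span_def big_image /= => /memv_sumP[w wF ->].
have /fin_all_exists[c wE] i : exists c, w i = c *: F i.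
  by have /vlineP := wF i isT.
by exists c; apply: eq_bigr.
Qed.

Lemma sum_tridiagonal (V : nmodType) (D : nat) (F : 'I_D.+1 -> V) (j : nat) :
    (j <= D)%N ->
    (forall k : 'I_D.+1, (j.+1 < k)%N || (k.+1 < j)%N -> F k = 0) ->
  \sum_k F k = F (inord j.-1) *+ (0 < j)%N + F (inord j) +
    F (inord j.+1) *+ (j < D)%N.
Proof.
move=> jD F0.
have sum_at (u : V) i : \sum_(k < D.+1) u *+ (k == i :> nat) = u *+ (i <= D)%N.
  transitivity (\sum_(k < D.+1 | k == i :> nat) u).
    by rewrite [RHS]big_mkcond; apply: eq_bigr => k _; case: eqP.
  by rewrite (big_ord1_eq +%R (fun=> u)) ltnS; case: leqP.
transitivity (\sum_(k < D.+1)
    (F (inord j.-1) *+ (0 < j)%N *+ (k == j.-1 :> nat) +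
     F (inord j) *+ (k == j :> nat) +
     F (inord j.+1) *+ (j < D)%N *+ (k == j.+1 :> nat))); last first.
  rewrite !big_split /= !sum_at jD (leq_trans (leq_pred j) jD).
  by case: (j < D)%N.
apply: eq_bigr => k _; rewrite -!mulrnA !mulnb.
pose near := [:: (0 < j) && (k == j.-1 :> nat); k == j :> nat;
  (j < D) && (k == j.+1 :> nat)]%N.
have [k_far|k_near] := boolP ((j.+1 < k) || (k.+1 < j))%N.
  have [-> -> ->] : near = [:: false; false; false] by congr [:: _; _; _]; lia.
  by rewrite F0 // !addr0.
have kD := ltn_ord k.
have [kj|[kj|kj]] : k.+1 = j \/ k = j :> nat \/ k = j.+1 :> nat by lia.
- have [-> -> ->] : near = [:: true; false; false] by congr [:: _; _; _]; lia.
  by rewrite -kj inord_val !addr0.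
- have [-> -> ->] : near = [:: false; true; false] by congr [:: _; _; _]; lia.
  by rewrite -kj inord_val addr0 add0r.
- have [-> -> ->] : near = [:: false; false; true] by congr [:: _; _; _]; lia.
  by rewrite -kj inord_val !add0r.
Qed.

Section BoseMesnerAlgebra.

Variables (R : realType) (X : finType) (D : nat).
Variable rel : 'I_D.+1 -> {set X * X}.
Hypothesis scheme : assoc_scheme R rel.

Local Notation A i := (adjmx R (rel i)).
Local Notation V := (bose_mesner R rel).

Lemma card_scheme_gt0 : (0 < #|X|)%N.
Proof.
have [/(_ ord0)/set0Pn[[a _] _] _ _ _ _] := scheme.
by apply/card_gt0P; exists a.
Qed.

Lemma bose_mesnerP (M : 'M[R]_#|X|) :
  M \in V <-> exists c, M = \sum_i c i *: A i.
Proof.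
split=> [/mem_span_image // | [c ->]].
apply: memv_suml => i _; apply/memvZ/memv_span/imageP; by exists i.
Qed.

Lemma bose_mesner_sym M : M \in V -> M^T = M.
Proof.
have [_ _ _ symA _] := scheme.
case/bose_mesnerP => c ->; rewrite linear_sum.
by apply: eq_bigr => i _ /=; rewrite linearZ /= symA.
Qed.

Lemma bose_mesner_mul M N : M \in V -> N \in V -> M *m N \in V.
Proof.
have [_ _ _ _ [p Ap]] := scheme.
case/bose_mesnerP => c -> /bose_mesnerP[d ->].
rewrite mulmx_suml; apply: memv_suml => i _.
rewrite mulmx_sumr; apply: memv_suml => j _.
rewrite -scalemxAl -scalemxAr Ap; do 2!apply: memvZ.
by apply/bose_mesnerP; exists (fun k => (p i j k)%:R).
Qed.

Lemma bose_mesnerC M N : M \in V -> N \in V -> M *m N = N *m M.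
Proof.
move=> MV NV; rewrite -(bose_mesner_sym (bose_mesner_mul MV NV)) trmx_mul.
by rewrite !bose_mesner_sym.
Qed.

Lemma bose_mesner1 : 1%:M \in V.
Proof.
have [_ <- _ _ _] := scheme.
by apply/memv_span/imageP; exists ord0.
Qed.

Lemma bose_mesner_diag M a b : M \in V -> M a a = M b b.
Proof.
have [_ A0 sumA _ _] := scheme.
have diagA i d : A i d d = (i == ord0)%:R.
  have [->|i0] := eqVneq; first by rewrite A0 mxE eqxx.
  have /matrixP/(_ d d) := sumA.
  rewrite summxE mxE (bigD1 ord0) //= A0 mxE eqxx -[RHS]addr0 => /addrI sum0.
  by apply: (psumr_eq0P _ sum0) => // j _; rewrite mxE ler0n.
case/bose_mesnerP => c ->; rewrite !summxE.
by apply: eq_bigr => i _; rewrite mxE diagA [RHS]mxE diagA.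
Qed.

End BoseMesnerAlgebra.

(* The coefficients are b*_{j-1} = (0 :: b)`_j, a*_j and c*_{j+1} = c`_j. For
   j = D the last one is the default 0, which discards the meaningless
   [v D.+1]; likewise b*_D = b`_D and c*_0 = (0 :: c)`_0 vanish. *)
Definition krein_recurrent (R : pzRingType) (D : nat) (b c : seq R)
    (v : nat -> R) : Prop :=
  forall j, (j <= D)%N ->
    v 1%N * v j = (0 :: b)`_j * v j.-1 +
      (b`_0 - b`_j - (0 :: c)`_j) * v j + c`_j * v j.+1.

Section PrimitiveIdempotents.

Variables (R : realType) (X : finType) (D : nat).
Variables (rel : 'I_D.+1 -> {set X * X}) (E : 'I_D.+1 -> 'M[R]_#|X|).
Hypothesis scheme : assoc_scheme R rel.
Hypothesis basisE : primitive_idempotent_basis rel E.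

Local Notation V := (bose_mesner R rel).

Lemma primitive_idempotent_bose_mesner i : E i \in V.
Proof. by have [_ /(_ i)[[]]] := basisE. Qed.

Lemma primitive_idempotent_neq0 i : E i != 0.
Proof. by have [_ /(_ i)[]] := basisE. Qed.

Let EV := primitive_idempotent_bose_mesner.

Let Eid i : E i *m E i = E i.
Proof. by have [_ /(_ i)[[]]] := basisE. Qed.

(* E_i = E_i E_j + E_i (1 - E_j) is a sum of orthogonal idempotents. *)
Lemma primitive_idempotent_absorb i j : E i *m E j = 0 \/ E i *m E j = E i.
Proof.
have EC : E j *m E i = E i *m E j by exact: (bose_mesnerC scheme).
have [_ /(_ i)[_ _ prim] _] := basisE.
have EEij : E i *m E j *m (E i *m E j) = E i *m E j.
  by rewrite mulmxA -(mulmxA (E i)) EC mulmxA Eid -mulmxA Eid.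
have EiEij : E i *m (E i *m E j) = E i *m E j by rewrite mulmxA Eid.
have EijEi : E i *m E j *m E i = E i *m E j by rewrite -mulmxA EC.
have EVij := bose_mesner_mul scheme (EV i) (EV j).
case: (prim (E i *m E j) (E i - E i *m E j)).
- by split.
- split; first by rewrite memvB.
  by rewrite mulmxBl !mulmxBr Eid EiEij EijEi EEij subrr subr0.
- by rewrite mulmxBr EijEi EEij subrr.
- by rewrite mulmxBl EiEij EEij subrr.
- by rewrite addrC subrK.
- by left.
- by move/eqP; rewrite subr_eq0 => /eqP <-; right.
Qed.

Lemma primitive_idempotent_ortho : orthogonal_idempotents E.
Proof.
move=> i j; case: eqP => [->|ij]; first exact: Eid.
have [//|Eij] := primitive_idempotent_absorb i j.
have EC : E i *m E j = E j *m E i by exact: (bose_mesnerC scheme).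
have [Eji|Eji] := primitive_idempotent_absorb j i; first by rewrite EC.
case: ij; have [_ _ /basis_free/free_uniq/injectiveP injE] := basisE.
by apply: injE; rewrite -Eij -[RHS]Eji EC.
Qed.

Lemma primitive_idempotent_sum : \sum_i E i = 1%:M.
Proof.
have [_ _ /span_basis spanE] := basisE.
have /mem_span_image[c one] : 1%:M \in <<[seq E i | i : 'I_D.+1]>>%VS.
  by rewrite spanE (bose_mesner1 scheme).
have cE k : c k *: E k = E k.
  rewrite -(mul_spectral_idempotent primitive_idempotent_ortho).
  by rewrite /spectral_mx -one mul1mx.
by rewrite one; apply: eq_bigr.
Qed.

Lemma primitive_idempotent_resolution : orthogonal_resolution E.
Proof.
split; [|exact: primitive_idempotent_ortho|exact: primitive_idempotent_sum].
by move=> l; apply: (bose_mesner_sym scheme).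
Qed.

Section KreinParameters.

Variable q : 'I_D.+1 -> 'I_D.+1 -> 'I_D.+1 -> R.
Hypothesis kreinE : krein_parameters E q.

Let X_neq0 : #|X|%:R != 0 :> R.
Proof. by rewrite pnatr_eq0 -lt0n (card_scheme_gt0 scheme). Qed.

Let hadamardE i j : #|X|%:R *: hadamard (E i) (E j) = spectral_mx E (q i j).
Proof. by rewrite kreinE scalerA divff // scale1r. Qed.

Lemma krein_parameter0 i k : q i ord0 k = (k == i)%:R.
Proof.
have [E0 _ _] := basisE.
move: k; apply: (spectral_mx_inj primitive_idempotent_ortho
  primitive_idempotent_neq0).
rewrite -hadamardE [RHS](bigD1 i) //= eqxx scale1r big1 => [|j /negbTE->].
  by apply/matrixP => a b; rewrite addr0 E0 !mxE mulr1 mulrCA divff // mulr1.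
by rewrite scale0r.
Qed.

Lemma krein_row_sum i k a : \sum_j q i j k = #|X|%:R * E i a a.
Proof.
move: k; apply: (spectral_mx_inj (c := fun k => \sum_j q i j k)
  (d := fun=> _) primitive_idempotent_ortho primitive_idempotent_neq0).
rewrite [RHS]/spectral_mx -scaler_sumr primitive_idempotent_sum.
transitivity (\sum_j #|X|%:R *: hadamard (E i) (E j)).
  under [RHS]eq_bigr => j _ do rewrite hadamardE.
  rewrite exchange_big; apply: eq_bigr => l _ /=; exact: scaler_suml.
apply/matrixP => u v; rewrite -scaler_sumr -scalerA mxE [RHS]mxE; congr (_ * _).
rewrite summxE; under eq_bigr => j _ do rewrite mxE.
rewrite -mulr_sumr -summxE primitive_idempotent_sum !mxE.
have [->|_] := eqVneq u v; last by rewrite !mulr0.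
by rewrite !mulr1; apply: (bose_mesner_diag scheme).
Qed.

End KreinParameters.

Section QPolynomial.

Variable q : 'I_D.+1 -> 'I_D.+1 -> 'I_D.+1 -> R.
Variables b c : seq R.
Hypothesis kreinE : krein_parameters E q.
Hypothesis Qpoly : Q_polynomial q.
Hypothesis arr : krein_array q b c.

Local Notation o := (inord : nat -> 'I_D.+1).

Let D_gt0 : (0 < D)%N.
Proof. by have [] := Qpoly. Qed.

Let krein_far (j k : 'I_D.+1) :
  (j.+1 < k)%N || (k.+1 < j)%N -> q (o 1) j k = 0.
Proof. by move=> /orP jk; have [_ /(_ j k)[/(_ jk)]] := Qpoly. Qed.

Lemma krein_bstar j : q (o 1) (o j.+1) (o j) *+ (j < D)%N = b`_j.
Proof.
have [szb _ /(_ j) arrj] := arr.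
by case: ltnP => [/arrj[]|Dj] //; rewrite nth_default ?szb.
Qed.

Lemma krein_cstar j : q (o 1) (o j) (o j.+1) *+ (j < D)%N = c`_j.
Proof.
have [_ szc /(_ j) arrj] := arr.
by case: ltnP => [/arrj[]|Dj] //; rewrite nth_default ?szc.
Qed.

Let o_val j : (j <= D)%N -> o j = j :> nat. Proof. exact: inordK. Qed.

Let krein_astar_row j : (j <= D)%N ->
  (0 :: c)`_j + q (o 1) (o j) (o j) + b`_j = \sum_i q (o 1) i (o j).
Proof.
move=> jD; rewrite (sum_tridiagonal jD) => [|i ij]; last first.
  by apply: krein_far; rewrite o_val // orbC.
rewrite krein_bstar; case: j jD => // j jD.
by rewrite /= -krein_cstar jD.
Qed.

Lemma krein_bstar0 a : #|X|%:R * E (o 1) a a = b`_0.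
Proof.
rewrite -(krein_row_sum kreinE _ (o 0)) -krein_astar_row //=.
rewrite (_ : o 0 = ord0); last by apply: val_inj; rewrite /= inordK.
by rewrite (krein_parameter0 kreinE) -val_eqE /= inordK // !add0r.
Qed.

Lemma krein_astar j : (j <= D)%N ->
  q (o 1) (o j) (o j) = b`_0 - b`_j - (0 :: c)`_j.
Proof.
move=> jD; have := krein_astar_row jD.
have [a _] := card_gt0P (card_scheme_gt0 scheme).
rewrite (krein_row_sum kreinE _ _ (enum_rank a)) krein_bstar0 => <-.
ring.
Qed.

Lemma Q_polynomial_recurrent x y :
  krein_recurrent D b c (fun k => #|X|%:R * E (o k) x y).
Proof.
move=> j jD; have X_neq0 : #|X|%:R != 0 :> R.
  by rewrite pnatr_eq0 -lt0n (card_scheme_gt0 scheme).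
have /matrixP/(_ x y) := kreinE (o 1) (o j).
rewrite mxE [RHS]mxE summxE (sum_tridiagonal jD) => [Ej|k jk]; last first.
  by rewrite mxE krein_far ?mul0r // o_val.
rewrite mulrACA Ej -krein_astar // -krein_cstar.
have -> : (0 :: b)`_j = q (o 1) (o j) (o j.-1) *+ (0 < j)%N.
  by case: j {Ej} jD => // j jD; rewrite /= -krein_bstar jD.
rewrite !mxE mulrA mulfK // -!mulrnAl.
ring.
Qed.

End QPolynomial.

End PrimitiveIdempotents.

Section KreinArray.

Variables (R : fieldType) (x : R).

Definition gq_cover_bstar : seq R :=
  [:: (x ^+ 2 + 1) / 2;
      (x ^+ 2 - 1) / 2;
      (x ^+ 2 + 1) ^+ 2 / (2 * x * (x + 1));
      (x - 1) * (x ^+ 2 + 1) / (4 * x);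
      (x ^+ 2 + 1) / (2 * x)].

Definition gq_cover_cstar : seq R :=
  [:: 1;
      (x - 1) * (x ^+ 2 + 1) / (2 * x * (x + 1));
      (x + 1) * (x ^+ 2 + 1) / (4 * x);
      (x - 1) * (x ^+ 2 + 1) / (2 * x);
      (x ^+ 2 + 1) / 2].

End KreinArray.

Local Notation bstar := gq_cover_bstar.
Local Notation cstar := gq_cover_cstar.

Lemma gq_cover_astar_eq0 (R : numFieldType) (x : R) (j : nat) :
    0 < x -> (j <= 5)%N ->
  (bstar x)`_0 - (bstar x)`_j - (0 :: cstar x)`_j = 0.
Proof.
move=> x_gt0; have x_neq0 : x != 0 by rewrite gt_eqF.
have xp1_neq0 : x + 1 != 0 by rewrite gt_eqF // addr_gt0.
by case: j => [|[|[|[|[|[|]]]]]] //= _; field; rewrite ?x_neq0 ?xp1_neq0.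
Qed.

Lemma gq_cover_two_term (R : numFieldType) (x : R) (v : nat -> R) (j : nat) :
    0 < x -> krein_recurrent 5 (bstar x) (cstar x) v -> (j <= 5)%N ->
  v 1%N * v j = (0 :: bstar x)`_j * v j.-1 + (cstar x)`_j * v j.+1.
Proof.
by move=> x_gt0 rec_v j5; rewrite rec_v // gq_cover_astar_eq0 // mul0r addr0.
Qed.

Section GQCover.

Variables (R : realFieldType) (s : R).
Hypothesis s_gt1 : 1 < s.

Local Notation x := (s ^+ 2).
Local Notation m := ((x ^+ 2 + 1) / 2).

Let x_gt1 : 1 < x. Proof. by move: s_gt1 => s1; nra. Qed.

Let x_gt0 : 0 < x. Proof. exact: lt_trans ltr01 x_gt1. Qed.

Let s_neq0 : s != 0. Proof. by rewrite gt_eqF ?(lt_trans _ s_gt1). Qed.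

Let xm1_neq0 : x - 1 != 0. Proof. by rewrite subr_eq0 gt_eqF. Qed.

Let xp1_neq0 : x + 1 != 0.
Proof. by rewrite gt_eqF //; move: x_gt1 => x1; lra. Qed.

Let x2p1_neq0 : x ^+ 2 + 1 != 0.
Proof. by rewrite gt_eqF //; move: x_gt1 => x1; nra. Qed.

Let neq0 := (s_neq0, xm1_neq0, xp1_neq0, x2p1_neq0).

(* The rows of the second eigenmatrix: v k is the value of |X| E_k. *)
Definition antipodal_row (e : R) : seq R :=
  [:: 1; e * m; x * (x + 1) ^+ 2 / 2; e * (x * (x ^+ 2 + 1)); x * m; e * m].

Definition collinear_row (e : R) : seq R :=
  [:: 1; e * (m / s); (x ^+ 2 - 1) / 2; 0; - m; - (e * (m / s))].

Definition far_row (e : R) : seq R :=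
  [:: 1; e * (m / x); - (x + 1) ^+ 2 / (2 * x); - (e * (2 * m / x)); m / x;
      e * (m / x)].

Variant entry_row_spec (w : seq R) : Prop :=
| AntipodalRow e of is_sign e & w = antipodal_row e
| CollinearRow e of is_sign e & w = collinear_row e
| FarRow e of is_sign e & w = far_row e.

Section EntryRows.

Variable v : nat -> R.
Hypothesis v0 : v 0%N = 1.
Hypothesis rec_v : krein_recurrent 5 (bstar x) (cstar x) v.

Let nextE j : (j < 5)%N ->
  v j.+1 = (v 1%N * v j - (0 :: bstar x)`_j * v j.-1) / (cstar x)`_j.
Proof.
move=> j5; rewrite (gq_cover_two_term x_gt0 rec_v) 1?ltnW // addrC addKr.
rewrite mulrC mulKf //; case: j j5 => [|[|[|[|[|]]]]] //= _;
  by rewrite ?oner_neq0 // !(mulf_neq0, invr_neq0) // pnatr_eq0.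
Qed.

Let v2E := nextE (isT : 1 < 5)%N.
Let v3E := nextE (isT : 2 < 5)%N.
Let v4E := nextE (isT : 3 < 5)%N.
Let v5E := nextE (isT : 4 < 5)%N.

(* The recurrence gives v j as a polynomial of degree j in v 1, and its last
   instance says that v 1 is a root of the polynomial of degree 6. *)
Lemma gq_cover_first_entry :
  exists2 e, is_sign e &
    [\/ v 1%N = e * m, v 1%N = e * (m / s) | v 1%N = e * (m / x)].
Proof.
have := gq_cover_two_term x_gt0 rec_v (leqnn 5).
rewrite v5E v4E v3E v2E /= v0; set t := v 1%N.
move=> /eqP; rewrite mul0r addr0 -subr_eq0.
set p := (X in X == 0); have {p} -> : p =
    (t ^+ 2 - m ^+ 2) * ((t * s) ^+ 2 - m ^+ 2) * ((t * x) ^+ 2 - m ^+ 2) /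
    (x ^+ 3 * \prod_(c <- cstar x) c).
  by rewrite /p !big_cons big_nil; field; rewrite !neq0.
have /negbTE prod_neq0 : x ^+ 3 * \prod_(c <- cstar x) c != 0.
  rewrite !big_cons big_nil.
  by rewrite !(mulf_neq0, expf_neq0, invr_neq0) // ?oner_neq0 ?pnatr_eq0.
have sign_root y k : k != 0 -> (t * k) ^+ 2 - m ^+ 2 == 0 -> y = m / k ->
    exists2 e, is_sign e & t = e * y.
  move=> k_neq0; rewrite subr_eq0 eqf_sqr => /orP tk ->.
  exists (t * k / m); last by field; rewrite k_neq0.
  by case: tk => /eqP->; [left | right]; field.
rewrite !mulf_eq0 invr_eq0 prod_neq0 orbF -orbA -{1}[t]mulr1.
case/or3P => /sign_root.
- case/(_ m); rewrite ?oner_neq0 ?divr1 // => e eP te.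
  by exists e => //; constructor 1.
- case/(_ (m / s)) => // e eP te; exists e => //; by constructor 2.
- case/(_ (m / x)); rewrite ?expf_neq0 // => e eP te.
  by exists e => //; constructor 3.
Qed.

Lemma gq_cover_entry_rowP : entry_row_spec (mkseq v 6).
Proof.
rewrite /mkseq /= v5E v4E v3E v2E /= v0.
have [e eP [->|->|->]] := gq_cover_first_entry;
  [apply: (AntipodalRow eP) | apply: (CollinearRow eP) | apply: (FarRow eP)];
  by case: eP => ->; congr [:: _; _; _; _; _; _]; field; rewrite ?neq0.
Qed.

End EntryRows.

Section SignedCollinearity.

Variables (n : nat) (E : 'I_6 -> 'M[R]_n).

Local Notation E_ k := (E (inord k)).
Local Notation spec e := (spectral_mx E (fun l => e`_l)).
Local Notation v a b := (fun k => n%:R * E (inord k) a b).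
Local Notation dot e w := (e`_0 * w`_0 + e`_1 * w`_1 + e`_2 * w`_2 +
  e`_3 * w`_3 + e`_4 * w`_4 + e`_5 * w`_5).

Hypothesis n_gt0 : (0 < n)%N.
Hypothesis resE : orthogonal_resolution E.
Hypothesis E0 : E_ 0 = n%:R^-1 *: const_mx 1.
Hypothesis diagE : forall a, n%:R * E_ 1 a a = m.
Hypothesis rec_E : forall a b,
  krein_recurrent 5 (bstar x) (cstar x) (v a b).

Let n_neq0 : n%:R != 0 :> R. Proof. by rewrite pnatr_eq0 -lt0n. Qed.

Let specE e : spec e = e`_0 *: E_ 0 + e`_1 *: E_ 1 + e`_2 *: E_ 2 +
  e`_3 *: E_ 3 + e`_4 *: E_ 4 + e`_5 *: E_ 5.
Proof.
rewrite /spectral_mx !big_ord_recl big_ord0 addr0 !addrA.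
by do !congr (_ + _); congr (_ *: E _); apply: val_inj; rewrite /= inordK.
Qed.

Let entry_rowP a b : entry_row_spec (mkseq (v a b) 6).
Proof.
apply: gq_cover_entry_rowP => //.
by rewrite E0 !mxE mulr1 divff.
Qed.

Let scaled_spec_entry e a b w : mkseq (v a b) 6 = w ->
  n%:R * spec e a b = dot e w.
Proof. by move=> <-; rewrite specE !mxE /=; ring. Qed.

Let sum_row a b w : mkseq (v a b) 6 = w ->
  dot (nseq 6 1) w = n%:R * (a == b)%:R.
Proof.
move/(scaled_spec_entry (nseq 6 1)) => <-; congr (_ * _).
have [_ _ sumE] := resE; have -> : spec (nseq 6 1) = 1%:M; last by rewrite mxE.
by rewrite -sumE; apply: eq_bigr => l _; rewrite nth_nseq ltn_ord scale1r.
Qed.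

Let diag_row a : mkseq (v a a) 6 = antipodal_row 1.
Proof.
have m_gt0 : 0 < m by move: x_gt1 => x1; nra.
case: (entry_rowP a a) => e eP rowE; have := congr1 (nth 0 ^~ 1%N) rowE;
  rewrite [nth _ _ _]diagE /=.
- by case: eP rowE => -> // _ m_opp; exfalso; lra.
- have m_s : m / s < m by rewrite ltr_pdivrMr ?(lt_trans _ s_gt1) // ltr_pMr.
  have ms_gt0 : 0 < m / s by rewrite divr_gt0 // (lt_trans _ s_gt1).
  by case: eP {rowE} => -> m_eq; exfalso; lra.
- have m_x : m / x < m by rewrite ltr_pdivrMr ?(lt_trans _ x_gt1) // ltr_pMr.
  have mx_gt0 : 0 < m / x by rewrite divr_gt0 // (lt_trans _ x_gt1).
  by case: eP {rowE} => -> m_eq; exfalso; lra.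
Qed.

Lemma gq_cover_order : n%:R = 2 * (x + 1) * (x ^+ 2 + 1) :> R.
Proof.
have := sum_row (diag_row (Ordinal n_gt0)); rewrite eqxx [RHS]mulr1 /= => <-.
by field.
Qed.

(* The signed collinearity matrix S of the quotient, lifted to the scheme; F is
   its signed non-collinearity matrix plus x times its signed identity, and
   B = S ⊙ S is the collinearity relation. *)
Definition collinear_sign : 'M[R]_n :=
  let k := 2 * s * (x + 1) in spec [:: 0; k; 0; 0; 0; - k].

Definition far_sign : 'M[R]_n :=
  let k := 2 * x * (x + 1) in spec [:: 0; k; 0; 0; 0; k].

Local Notation S := collinear_sign.
Local Notation F := far_sign.
Local Notation B := (S ⊙ S).

Let spec_entry e a b w : mkseq (v a b) 6 = w ->
  spec e a b = dot e w / (2 * (x + 1) * (x ^+ 2 + 1)).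
Proof.
by move/scaled_spec_entry <-; rewrite -gq_cover_order mulrAC divff // mul1r.
Qed.

Lemma collinearE :
  B = spec [:: 2 * x * (x + 1); 0; 2 * (x - 1); 0; - (2 * (x + 1)); 0].
Proof.
apply/matrixP => a b; rewrite mxE.
case: (entry_rowP a b) => e [] -> rowE; rewrite !(spec_entry _ rowE) /=; field;
  by rewrite ?neq0.
Qed.

Lemma collinear2E : B *m B =
  spec [:: (2 * x * (x + 1)) ^+ 2; 0; (2 * (x - 1)) ^+ 2; 0;
           (2 * (x + 1)) ^+ 2; 0].
Proof.
have [_ orthoE _] := resE; rewrite collinearE mul_spectral_mx //.
apply: eq_spectral_mx => -[[|[|[|[|[|[|//]]]]]] ?] /=; ring.
Qed.

Lemma collinear_sign2E : S *m S = (2 * (x + 1)) *: F.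
Proof.
have [_ orthoE _] := resE; rewrite mul_spectral_mx // scale_spectral_mx.
apply: eq_spectral_mx => -[[|[|[|[|[|[|//]]]]]] ?] /=; ring.
Qed.

Lemma mul_collinear_sign : B *m S = 0.
Proof.
have [_ orthoE _] := resE; rewrite collinearE mul_spectral_mx //.
apply: big1 => -[[|[|[|[|[|[|//]]]]]] ?] _ /=; by rewrite ?mulr0 ?mul0r scale0r.
Qed.

Lemma trmx_collinear_sign : S^T = S.
Proof.
have [trE _ _] := resE; rewrite linear_sum; apply: eq_bigr => l _ /=.
by rewrite linearZ /= trE.
Qed.

Variant pair_spec (a b : 'I_n) : R -> R -> R -> Prop :=
| PairEqual of a = b : pair_spec a b 0 x (2 * x * (x + 1))
| PairAntipodal : pair_spec a b 0 (- x) (2 * x * (x + 1))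
| PairCollinear e of is_sign e : pair_spec a b e 0 (2 * (x - 1))
| PairFar e of is_sign e : pair_spec a b 0 e (2 * (x + 1)).

Lemma pairP a b : pair_spec a b (S a b) (F a b) ((B *m B) a b).
Proof.
rewrite collinear2E; set BB := (X in pair_spec _ _ _ _ X).
case: (entry_rowP a b) => e eP rowE.
- have [-> -> ->] : [/\ S a b = 0, F a b = e * x & BB = 2 * x * (x + 1)].
    by split; rewrite ?/BB (spec_entry _ rowE) /=; field; rewrite ?neq0.
  case: eP rowE => -> rowE; last by rewrite mulN1r; constructor.
  rewrite mul1r; constructor; apply/eqP/contraT => /negbTE ab.
  by have := sum_row rowE; rewrite ab mulr0 /=; move: x_gt1 => x1; nra.
- have [-> -> ->] : [/\ S a b = e, F a b = 0 & BB = 2 * (x - 1)].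
    by split; rewrite ?/BB (spec_entry _ rowE) /=; field; rewrite ?neq0.
  by constructor.
- have [-> -> ->] : [/\ S a b = 0, F a b = e & BB = 2 * (x + 1)].
    by split; rewrite ?/BB (spec_entry _ rowE) /=; field; rewrite ?neq0.
  by constructor.
Qed.

Lemma collinear_sign_val a b : [\/ S a b = 0, S a b = 1 | S a b = -1].
Proof. by case: (pairP a b) => [|| _ []->|]; constructor. Qed.

Lemma collinear_pair a b : S a b != 0 ->
  F a b = 0 /\ (B *m B) a b = 2 * (x - 1).
Proof. by case: (pairP a b); rewrite ?eqxx. Qed.

Lemma far_pair a b : is_sign (F a b) -> (B *m B) a b = 2 * (x + 1).
Proof.
case: (pairP a b) => // [_||e _]; have x1 := x_gt1;
  by case=> F1; exfalso; lra.
Qed.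

Lemma diag_signs a : S a a = 0 /\ F a a = x.
Proof.
by split; rewrite (spec_entry _ (diag_row a)) /=; field; rewrite ?neq0.
Qed.

Let trS a b : S a b = S b a.
Proof. exact/trmx_entryC/trmx_collinear_sign. Qed.

(* The rows of a and b in S are opposite, as their sum has squared norm
   2 (x + 1) (F a a + 2 F a b + F b b). *)
Lemma antipodal_sign a b c : F a b = - x -> S c a = - S c b.
Proof.
move=> Fab; have FE u w : \sum_d S u d * S w d = 2 * (x + 1) * F u w.
  transitivity ((S *m S) u w); last by rewrite collinear_sign2E mxE.
  by rewrite mxE; apply: eq_bigr => d _; rewrite (trS w).
have sum0 : \sum_d (S a d + S b d) ^+ 2 = 0.
  transitivity (2 * (x + 1) * F a a + 2 * (2 * (x + 1) * F a b) +
    2 * (x + 1) * F b b).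
    by rewrite -!FE mulr_sumr -!big_split; apply: eq_bigr => d _ /=; ring.
  have [[_ ->] [_ ->]] := (diag_signs a, diag_signs b).
  by rewrite Fab; ring.
have /eqP : (S a c + S b c) ^+ 2 = 0.
  by apply: (psumr_eq0P _ sum0) => // d _; apply: sqr_ge0.
by rewrite sqrf_eq0 addr_eq0 !(trS _ c) => /eqP.
Qed.

Local Notation c2 := ((x - 1) * (x ^+ 2 + 1) / (2 * x * (x + 1))).
Local Notation b4 := ((x ^+ 2 + 1) / (2 * x)).

Let E11 : E_ 1 ⊙ E_ 1 = spec [:: m / n%:R; 0; c2 / n%:R; 0; 0; 0].
Proof.
apply/matrixP => a b; rewrite specE !mxE /=.
have /= rec1 := gq_cover_two_term x_gt0 (rec_E a b) (isT : 1 <= 5)%N.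
apply: (mulfI n_neq0); apply: (mulfI n_neq0).
transitivity (n%:R * E_ 1 a b * (n%:R * E_ 1 a b)); first by ring.
by rewrite rec1; field; rewrite ?neq0 ?n_neq0.
Qed.

Let E15 : E_ 1 ⊙ E_ 5 = spec [:: 0; 0; 0; 0; b4 / n%:R; 0].
Proof.
apply/matrixP => a b; rewrite specE !mxE /=.
have /= rec5 := gq_cover_two_term x_gt0 (rec_E a b) (isT : 5 <= 5)%N.
apply: (mulfI n_neq0); apply: (mulfI n_neq0).
transitivity (n%:R * E_ 1 a b * (n%:R * E_ 5 a b)); first by ring.
by rewrite rec5; field; rewrite ?neq0 ?n_neq0.
Qed.

Let E51 : E_ 5 ⊙ E_ 1 = spec [:: 0; 0; 0; 0; b4 / n%:R; 0].
Proof. by rewrite map2_mxC E15. Qed.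

Let E55 : E_ 5 ⊙ E_ 5 = spec [:: m / n%:R; 0; c2 / n%:R; 0; 0; 0].
Proof.
rewrite -E11; apply/matrixP => a b; rewrite !mxE.
have entryE k : (k < 6)%N -> E_ k a b = (mkseq (v a b) 6)`_k / n%:R.
  by move=> k6; rewrite nth_mkseq // mulrAC divff // mul1r.
by rewrite !entryE //; case: (entry_rowP a b) => e _ -> /=; ring.
Qed.

Local Notation u i j a b := (row a (E_ i) ⊙ row b (E_ j)).

(* This differs from B by a multiple of E_0, so that it has the same eigenvalue
   on the images of E_0 and E_2, which occur in E_1 ⊙ E_1 and E_5 ⊙ E_5. *)
Local Notation B' :=
  (spec [:: 2 * (x - 1); 0; 2 * (x - 1); 0; - (2 * (x + 1)); 0]).

Lemma same_type_rows_collinear a b :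
  u 1 1 a b *m B' = (2 * (x - 1)) *: u 1 1 a b /\
  u 5 5 a b *m B' = (2 * (x - 1)) *: u 5 5 a b.
Proof.
split; [apply: (hadamard_rows_mul_spectral a b resE E11) |
        apply: (hadamard_rows_mul_spectral a b resE E55)];
  by case=> -[|[|[|[|[|[|//]]]]]] //= ?; rewrite eqxx.
Qed.

Lemma mixed_type_rows_collinear a b :
  u 1 5 a b *m B' = - (2 * (x + 1)) *: u 1 5 a b /\
  u 5 1 a b *m B' = - (2 * (x + 1)) *: u 5 1 a b.
Proof.
split; [apply: (hadamard_rows_mul_spectral a b resE E15) |
        apply: (hadamard_rows_mul_spectral a b resE E51)];
  by case=> -[|[|[|[|[|[|//]]]]]] //= ?; rewrite eqxx.
Qed.

Lemma row_mul_E0 i j a b :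
  u i j a b *m E_ 0 = const_mx ((E_ i *m E_ j) a b / n%:R).
Proof.
have [trE _ _] := resE; apply/rowP => c; rewrite !mxE mulr_suml.
by apply: eq_bigr => w _; rewrite E0 !mxE mulr1 (trmx_entryC b w (trE _)).
Qed.

Let adjacent_entries a b : S a b != 0 ->
  E_ 1 a b = S a b / (4 * s * (x + 1)) /\
  E_ 5 a b = - (S a b / (4 * s * (x + 1))).
Proof.
case/collinear_pair => + _; rewrite /far_sign /collinear_sign !specE !mxE /=.
move=> F0; have E5_opp : E_ 5 a b = - E_ 1 a b.
  apply/eqP; rewrite -addr_eq0 addrC; apply/eqP.
  apply: (@mulfI _ (2 * x * (x + 1))); last by rewrite mulr0 -F0; ring.
  by rewrite !mulf_neq0 // ?neq0 ?pnatr_eq0.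
by rewrite E5_opp; split; field; rewrite ?neq0.
Qed.

Lemma collinear_triple_sum a b c : S a c != 0 -> S b c != 0 ->
  \sum_w S a w * S b w * B w c = 2 * (F a b - S a c * S b c).
Proof.
move=> ac bc; have [_ orthoE _] := resE.
have Ssplit : row a S ⊙ row b S = (2 * s * (x + 1)) ^+ 2 *:
    (u 1 1 a b + u 5 5 a b - (u 1 5 a b + u 5 1 a b)).
  by apply/rowP => w; rewrite /collinear_sign !specE !mxE /=; ring.
have Bsplit : B = B' + (2 * (x ^+ 2 + 1)) *: E_ 0.
  by apply/matrixP => d w; rewrite collinearE !specE !mxE /=; ring.
transitivity (((row a S ⊙ row b S) *m B) 0 c).
  by rewrite [RHS]mxE; apply: eq_bigr => w _; rewrite !mxE.
have [u11 u55] := same_type_rows_collinear a b.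
have [u15 u51] := mixed_type_rows_collinear a b.
have E0_part : (u 1 1 a b + u 5 5 a b - (u 1 5 a b + u 5 1 a b)) *m E_ 0 =
    const_mx ((E_ 1 a b + E_ 5 a b) / n%:R).
  rewrite !(mulmxDl, mulNmx) !row_mul_E0 !orthoE -!val_eqE /= !inordK //=.
  by apply/rowP => w; rewrite !mxE; ring.
rewrite Ssplit Bsplit -scalemxAl mulmxDr -scalemxAr E0_part.
rewrite !(mulmxDl, mulNmx) u11 u55 u15 u51 !mxE.
have [-> ->] := adjacent_entries ac; have [-> ->] := adjacent_entries bc.
rewrite /far_sign specE !mxE /= gq_cover_order.
by field; rewrite ?neq0.
Qed.

(* By comparing (S^2)(a,b) with (B^2)(a,b), all 2-paths between a and b have
   the same sign, so that no cancellation occurs in [collinear_triple_sum]. *)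
Lemma far_path_sign a b w : is_sign (F a b) ->
  B a w * B b w = F a b * (S a w * S b w).
Proof.
move=> Fab; apply/eqP; rewrite -subr_eq0; apply/eqP; move: w.
have sum0 : \sum_w (B a w * B b w - F a b * (S a w * S b w)) = 0.
  transitivity ((B *m B) a b - F a b * (S *m S) a b).
    rewrite !mxE mulr_sumr -sumrB.
    by apply: eq_bigr => w _; rewrite !mxE (trS w b).
  rewrite far_pair // collinear_sign2E mxE.
  by case: Fab => ->; ring.
move=> w; apply: (psumr_eq0P _ sum0) => // {}w _; rewrite !mxE.
by case: (collinear_sign_val a w) => ->; case: (collinear_sign_val b w) => ->;
  case: Fab => ->; lra.
Qed.

Lemma far_common_neighbours a b c w : is_sign (F a b) ->
    S a c != 0 -> S b c != 0 -> S a w != 0 -> S b w != 0 -> S c w = 0.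
Proof.
move=> Fab ac bc aw bw.
have path_c : S a c * S b c = F a b.
  have := far_path_sign c Fab; rewrite !mxE; move: ac bc.
  by case: (collinear_sign_val a c) => ->; rewrite ?eqxx // => _;
    case: (collinear_sign_val b c) => ->; rewrite ?eqxx // => _; lra.
have sumBBB : \sum_d B a d * B b d * B d c = 0.
  transitivity (F a b * \sum_d S a d * S b d * B d c).
    rewrite mulr_sumr; apply: eq_bigr => d _.
    by rewrite far_path_sign // !mulrA.
  by rewrite collinear_triple_sum // path_c subrr mulr0 mulr0.
have /eqP : B a w * B b w * B w c = 0.
  apply: (psumr_eq0P _ sumBBB) => // d _.
  by rewrite !mxE -!expr2 -!exprMn sqr_ge0.
rewrite !mxE !mulf_eq0 !orbb (negbTE aw) (negbTE bw) /= trS.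
by move/eqP.
Qed.

Lemma collinear_trans a b c w : S c a != 0 -> S c a = S c b ->
  S c w != 0 -> S a w != 0 -> S b w != 0 -> a = b \/ S a b != 0.
Proof.
move=> ca ca_cb cw aw bw; have x1 := x_gt1.
have : F a b = - x -> S c a = - S c b by exact: antipodal_sign.
have : is_sign (F a b) -> S c w = 0.
  move=> Fab; apply: (far_common_neighbours (a := a) (b := b)) => //.
    by rewrite trS.
  by rewrite trS -ca_cb.
case: (pairP a b) => [-> | | e eP | e eP] cw0 antipodal.
- by left.
- by have /esym/eqP := antipodal erefl; rewrite -ca_cb eqNr (negbTE ca).
- by right; case: eP => ->; rewrite ?oppr_eq0 oner_eq0.
- by rewrite cw0 ?eqxx in cw.
Qed.

Lemma exists_collinear a : exists b, S a b != 0.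
Proof.
apply/existsP/contraT => /existsPn S0.
have : (S *m S) a a == 0.
  rewrite mxE big1 // => b _.
  by have := S0 b; rewrite negbK => /eqP->; rewrite mul0r.
rewrite collinear_sign2E mxE; have [_ ->] := diag_signs a.
by apply/contraTT => _; rewrite !mulf_neq0 ?pnatr_eq0 ?xp1_neq0.
Qed.

Lemma dvdn4_gq_cover (r : nat) : x = r%:R -> (4 %| r * r.-1)%N.
Proof.
move=> xr; pose a := Ordinal n_gt0; have [b ab] := exists_collinear a.
apply: (dvdn4_signed_line _ _ _ _ _ _ _ ab).
- exact: trmx_collinear_sign.
- by move=> d; have [] := diag_signs d.
- exact: collinear_sign_val.
- exact: mul_collinear_sign.
- move=> d w dw; rewrite collinear_sign2E mxE.
  by have [-> _] := collinear_pair dw; rewrite mulr0.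
- by move=> d w /collinear_pair[_]; rewrite xr.
- exact: collinear_trans.
Qed.

End SignedCollinearity.

End GQCover.

Lemma dvdn4_gq_cover_scheme (R : realType) (r : nat) (X : finType) (D : nat)
    (rel : 'I_D.+1 -> {set X * X}) :
    (1 < r)%N -> Q_polynomial_scheme rel (bstar (r%:R : R)) (cstar r%:R) ->
  (4 %| r * r.-1)%N.
Proof.
move=> r_gt1; pose s : R := Num.sqrt r%:R.
have s2 : s ^+ 2 = r%:R by rewrite sqr_sqrtr.
have s_gt1 : 1 < s by rewrite -[1]sqrtr1 ltr_sqrt ?ltr0n ?ltr1n // ltnW.
rewrite -s2 => -[scheme [E [q [basisE kreinE Qpoly arr]]]].
have [/= D5 _ _] := arr; subst D.
have [E0 _ _] := basisE.
apply: (dvdn4_gq_cover s_gt1 (card_scheme_gt0 scheme)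
  (primitive_idempotent_resolution scheme basisE)) s2.
- by rewrite -E0; congr E; apply: val_inj; rewrite /= inordK.
- by move=> a; rewrite (krein_bstar0 scheme basisE kreinE Qpoly arr).
- move=> a b.
  exact: (Q_polynomial_recurrent scheme basisE kreinE Qpoly arr).
Qed.

Theorem theorem4p10 (R : realType) (r : nat) (r_gt0 : (0 < r)%N)
    (r_mod4 : (r = 3 %[mod 4])%N) :
  let x : R := r%:R in
  ~ exists (X : finType) (D : nat) (rel : 'I_D.+1 -> {set X * X}),
      Q_polynomial_scheme rel
        [:: (x ^+ 2 + 1) / 2;
            (x ^+ 2 - 1) / 2;
            (x ^+ 2 + 1) ^+ 2 / (2 * x * (x + 1));
            (x - 1) * (x ^+ 2 + 1) / (4 * x);
            (x ^+ 2 + 1) / (2 * x)]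
        [:: 1;
            (x - 1) * (x ^+ 2 + 1) / (2 * x * (x + 1));
            (x + 1) * (x ^+ 2 + 1) / (4 * x);
            (x - 1) * (x ^+ 2 + 1) / (2 * x);
            (x ^+ 2 + 1) / 2].
Proof.
move=> x [X [D [rel scheme]]].
have r3 : (r %% 4 = 3)%N by rewrite r_mod4.
have r_gt1 : (1 < r)%N by case: r r3 {r_gt0 r_mod4 x scheme} => [|[|]].
have /dvdnP[k rr] := dvdn4_gq_cover_scheme r_gt1 scheme.
move: rr; rewrite (divn_eq r 4) r3; nia.
Qed.
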